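(* Let $N\ge 3$, $n\ge 1$, let $a_1,\dots,a_n\in\mathbb{R}^N$ be distinct poles, and let $r_0=\min_{i\ne j}|a_i-a_j|/2$. Let $\beta>0$ and let $\mu\ge 0$ be a weight function on $\mathbb{R}^N$ satisfying the following two hypotheses. $H_1)$ $\nabla\mu\in L^1_{loc}(\mathbb{R}^N)$, $\sqrt{\mu}\in H^1_{loc}(\mathbb{R}^N)$ and $\mu^{-1}\in L^1_{loc}(\mathbb{R}^N)$. $H_2)$ There exist constants $k_1,k_2\in\mathbb{R}$, $k_2>2-N$, such that $$\beta\sum_{i=1}^n\frac{x-a_i}{|x-a_i|^2}\cdot\nabla\mu\ \ge\ \Bigl(-k_1+\sum_{i=1}^n\frac{k_2\beta}{|x-a_i|^2}\Bigr)\mu .$$ Then, for any $\varphi\in H^1_\mu$, $$\frac{c_o(N+k_2)}{n}\int_{\mathbb{R}^N}\sum_{i=1}^n\frac{\varphi^2}{|x-a_i|^2}\,d\mu+\frac{\beta^2}{2}\int_{\mathbb{R}^N}\sum_{\substack{i,j=1\\ i\ne j}}^n\frac{|a_i-a_j|^2}{|x-a_i|^2|x-a_j|^2}\,\varphi^2\,d\mu\ \le\ \int_{\mathbb{R}^N}|\nabla\varphi|^2\,d\mu+k_1\int_{\mathbb{R}^N}\varphi^2\,d\mu,$$ where $c_o(N+k_2):=\left(\frac{N+k_2-2}{2}\right)^2$.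
   Context: Here $d\mu(x)=\mu(x)\,dx$ and $L^2_\mu:=L^2(\mathbb{R}^N,d\mu)$. The weighted Sobolev space $H^1_\mu$ is the completion of $C_c^\infty(\mathbb{R}^N)$ with respect to the norm $\|u\|_{H^1_\mu}^2:=\|u\|_{L^2_\mu}^2+\|\nabla u\|_{L^2_\mu}^2$. The parameter $\beta>0$ is the coefficient of the vector field $F(x)=\sum_{i=1}^n\beta\,\frac{x-a_i}{|x-a_i|^2}\,\mu$ used in the vector field method.
   Formalization: The formal theorem fixes β = (N+k₂−2)/(2n), the value giving the constant c_o(N+k₂)/n; for arbitrary β>0 the claim is false (n=2, μ=1, k₁=k₂=0, β large). *)

(* Defs.v *)
From HB Require Import structures.
From mathcomp Require Import all_boot all_order all_algebra.
From mathcomp Require Import all_classical all_reals all_analysis.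
From mathcomp Require Import measurable_realfun.

Set Implicit Arguments.
Unset Strict Implicit.
Unset Printing Implicit Defensive.
Import Order.TTheory GRing.Theory Num.Theory.
Import numFieldNormedType.Exports.
Local Open Scope classical_set_scope.
Local Open Scope ring_scope.

(* R^N is 'rV[R]_N.  Its library norm is the sup norm, so the Euclidean
   structure is introduced through the scalar product. *)
Definition dotv (R : realType) (N : nat) (u v : 'rV[R]_N) : R :=
  \sum_(k < N) u ord0 k * v ord0 k.

Definition sqnorm (R : realType) (N : nat) (u : 'rV[R]_N) : R := dotv u u.

(* The sigma-algebra on R^N is generated by the coordinates, as the library
   does for tuples; it is the Borel sigma-algebra. *)
Definition rV_display : measure_display. Proof. exact: default_measure_display. Qed.

Section measurable_rV.
Context (R : realType) (N : nat).

Let coord : 'I_N -> 'rV[R]_N -> measurableTypeR R := fun i x => x ord0 i.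

Let rV_set0 : g_sigma_preimage coord set0.
Proof. exact: sigma_algebra0. Qed.

Let rV_setC A : g_sigma_preimage coord A -> g_sigma_preimage coord (~` A).
Proof. exact: sigma_algebraC. Qed.

Let rV_bigcup (F : _^nat) : (forall i, g_sigma_preimage coord (F i)) ->
  g_sigma_preimage coord (\bigcup_i (F i)).
Proof. exact: sigma_algebra_bigcup. Qed.

HB.instance Definition _ := @isMeasurable.Build rV_display
  'rV[R]_N (g_sigma_preimage coord) rV_set0 rV_setC rV_bigcup.

End measurable_rV.

Lemma measurable_coord (R : realType) (N : nat) (i : 'I_N) :
  measurable_fun setT (fun x : 'rV[R]_N => (x ord0 i : measurableTypeR R)).
Proof.
move=> _ Y mY; rewrite setTI; apply: sub_sigma_algebra => /=.
rewrite -bigcup_seq/=; exists i => /=; first by rewrite mem_index_enum.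
by exists Y => //; rewrite setTI.
Qed.

Lemma measurable_fun_rVP d (T : measurableType d) (R : realType) (N : nat)
    (f : T -> 'rV[R]_N) :
  (forall i, measurable_fun setT (fun x => (f x ord0 i : measurableTypeR R))) ->
  measurable_fun setT f.
Proof.
move=> mf _ A mA; rewrite setTI.
suff : preimage_set_system setT f
   (g_sigma_preimage (fun (i : 'I_N) (x : 'rV[R]_N) =>
     (x ord0 i : measurableTypeR R))) `<=` measurable.
  by apply; exists A => //; rewrite setTI.
rewrite -g_sigma_preimage_comp.
apply: smallest_sub; first exact: sigma_algebra_measurable.
case: N f mf A mA => [|n] f mf A mA; first by rewrite big_ord0.
rewrite -bigcup_mkord_ord; apply: bigcup_sub => i Ii.
by move=> B [C mC <-]; exact: mf.
Qed.

Definition consv (R : realType) (N : nat) (p : measurableTypeR R * 'rV[R]_N) :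
    'rV[R]_N.+1 :=
  \row_i (if unlift ord0 i is Some j then p.2 ord0 j else p.1).

Definition unconsv (R : realType) (N : nat) (x : 'rV[R]_N.+1) :
    measurableTypeR R * 'rV[R]_N :=
  (x ord0 ord0, \row_j x ord0 (lift ord0 j)).

Lemma consvK (R : realType) (N : nat) : cancel (@consv R N) (@unconsv R N).
Proof.
move=> [t v]; rewrite /unconsv /consv; congr pair; first by rewrite mxE unlift_none.
by apply/rowP => j; rewrite !mxE liftK.
Qed.

Lemma unconsvK (R : realType) (N : nat) : cancel (@unconsv R N) (@consv R N).
Proof.
by move=> x; apply/rowP => i; rewrite mxE; case: unliftP => [j|] -> //=; rewrite mxE.
Qed.

Lemma measurable_consv (R : realType) (N : nat) :
  measurable_fun setT (@consv R N).
Proof.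
apply: measurable_fun_rVP => i.
under eq_fun do rewrite mxE.
case: unliftP => [j _|_]; last exact: measurable_fst.
by apply: (measurableT_comp (measurable_coord j)); exact: measurable_snd.
Qed.

Lemma measurable_unconsv (R : realType) (N : nat) :
  measurable_fun setT (@unconsv R N).
Proof.
apply: measurable_fun_pair; first exact: measurable_coord.
apply: measurable_fun_rVP => i; under eq_fun do rewrite mxE.
exact: measurable_coord.
Qed.

Section lebesgue_rV.
Local Open Scope ereal_scope.
Context (R : realType) (N : nat).
Variable m : {sigma_finite_measure set 'rV[R]_N -> \bar R}.

Definition lebesgue_rV_step : set 'rV[R]_N.+1 -> \bar R :=
  pushforward (lebesgue_measure \x m) (@consv R N).

Let step0 : lebesgue_rV_step set0 = 0.
Proof. by rewrite /lebesgue_rV_step /pushforward preimage_set0 measure0. Qed.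

Let step_ge0 A : 0 <= lebesgue_rV_step A.
Proof. exact: (measure_ge0 (lebesgue_measure \x m)). Qed.

Let step_sigma_additive : semi_sigma_additive lebesgue_rV_step.
Proof.
move=> F mF tF mUF; rewrite /lebesgue_rV_step /pushforward preimage_bigcup.
have mpre A : measurable A -> measurable (@consv R N @^-1` A).
  by move=> mA; rewrite -[X in measurable X]setTI; exact: measurable_consv.
apply: measure_semi_sigma_additive.
- by move=> n; exact: mpre.
- apply/trivIsetP => /= i j _ _ ij; rewrite -preimage_setI.
  by move/trivIsetP : tF => /(_ _ _ _ _ ij) ->//; rewrite preimage_set0.
- by rewrite -preimage_bigcup; exact: mpre.
Qed.

HB.instance Definition _ := isMeasure.Build _ _ _ lebesgue_rV_step
  step0 step_ge0 step_sigma_additive.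

Let step_sigma_finite : sigma_finite setT lebesgue_rV_step.
Proof.
have /sigma_finiteP[F [TF ndF Foo]] :=
  sigma_finiteT (@lebesgue_measure R : {sigma_finite_measure set _ -> \bar R}).
have /sigma_finiteP[G [TG ndG Goo]] := sigma_finiteT m.
exists (fun k => @unconsv R N @^-1` (F k `*` G k)).
  rewrite -preimage_bigcup -(@preimage_setT _ _ (@unconsv R N)).
  congr (_ @^-1` _); rewrite -setXTT TF TG predeqE => -[x y]; split.
    move=> [/= [n _ Fnx] [k _ Gky]]; exists (maxn n k) => //; split.
    - by move: x Fnx; exact/subsetPset/ndF/leq_maxl.
    - by move: y Gky; exact/subsetPset/ndG/leq_maxr.
  by move=> [n _ []/= ? ?]; split; exists n.
move=> k; have [mF Fk] := Foo k; have [mG Gk] := Goo k; split.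
  by rewrite -[X in measurable X]setTI; apply: measurable_unconsv => //;
    exact: measurableX.
rewrite /lebesgue_rV_step /pushforward -comp_preimage.
rewrite (_ : _ \o _ = id); last by apply/funext => p; exact: consvK.
by rewrite preimage_id product_measure1E// lte_mul_pinfty// ge0_fin_numE.
Qed.

HB.instance Definition _ := Measure_isSigmaFinite.Build _ _ _ lebesgue_rV_step
  step_sigma_finite.

End lebesgue_rV.

(* N-dimensional Lebesgue measure, by iterated products. *)
Fixpoint lebesgue_rV (R : realType) (N : nat) :
    {sigma_finite_measure set 'rV[R]_N -> \bar R} :=
  match N with
  | 0 => \d_(0 : 'rV[R]_0)
  | N'.+1 => lebesgue_rV_step (lebesgue_rV R N')
  end.

Lemma lebesgue_rV_box (R : realType) (N : nat) (a b : 'I_N -> R) :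
  (forall i, a i <= b i) ->
  lebesgue_rV R N [set x | forall i, a i <= x ord0 i <= b i] =
  (\prod_(i < N) (b i - a i))%:E.
Proof.
elim: N a b => [|N IH] a b ab.
  rewrite big_ord0 /= diracE (_ : _ \in _) //.
  by rewrite inE /= => -[].
rewrite big_ord_recl /= /lebesgue_rV_step /pushforward.
have -> : @consv R N @^-1` [set x | forall i, a i <= x ord0 i <= b i] =
    `[a ord0, b ord0] `*` [set x : 'rV[R]_N | forall i : 'I_N,
       a (lift ord0 i) <= x ord0 i <= b (lift ord0 i)].
  apply/seteqP; split => -[t v] /=.
    move=> H; split.
      by have := H ord0; rewrite mxE unlift_none /= in_itv.
    by move=> i; have := H (lift ord0 i); rewrite mxE liftK.
  rewrite in_itv /= => -[H1 H2] i; rewrite mxE.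
  by case: unliftP => [j|] ->.
have mbox : measurable [set x : 'rV[R]_N | forall i : 'I_N,
    a (lift ord0 i) <= x ord0 i <= b (lift ord0 i)].
  rewrite (_ : [set _ | _] = \bigcap_(i in [set: 'I_N])
      ((fun x : 'rV[R]_N => (x ord0 i : measurableTypeR R)) @^-1`
         `[a (lift ord0 i), b (lift ord0 i)])).
    apply: fin_bigcap_measurable => // i _.
    by rewrite -[X in measurable X]setTI; apply: measurable_coord.
  by apply/seteqP; split => x /= H i; have := H i; rewrite /= in_itv/=; exact.
have E : lebesgue_measure `[a ord0, b ord0] = (b ord0 - a ord0)%:E.
  rewrite lebesgue_measure_itv /= lte_fin.
  have := ab ord0; rewrite le_eqVlt => /predU1P[->|->]; last by rewrite EFinB.
  by rewrite ltxx subrr.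
by rewrite product_measure1E //= E (IH (fun i => a (lift ord0 i))
  (fun i => b (lift ord0 i))) // EFinM.
Qed.

Definition gradient (R : realType) (N : nat) (f : 'rV[R]_N -> R)
    (x : 'rV[R]_N) : 'rV[R]_N :=
  \row_(i < N) 'D_(delta_mx ord0 i) f x.

Definition iter_partial (R : realType) (N : nat) (s : seq 'I_N)
    (f : 'rV[R]_N -> R) : 'rV[R]_N -> R :=
  foldr (fun i g => 'D_(delta_mx ord0 i) g) f s.

(* C_c^oo(R^N): all iterated partial derivatives exist and are continuous. *)
Definition test_function (R : realType) (N : nat) (f : 'rV[R]_N -> R) : Prop :=
  (forall s : seq 'I_N, continuous (iter_partial s f) /\
     forall (i : 'I_N) (x : 'rV[R]_N),
       derivable (iter_partial s f) x (delta_mx ord0 i)) /\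
  compact (closure [set x | f x != 0]).

Definition L1loc (R : realType) (N : nat) (f : 'rV[R]_N -> \bar R) : Prop :=
  measurable_fun setT f /\
  forall K : set 'rV[R]_N, compact K -> (lebesgue_rV R N).-integrable K f.

Definition L2loc (R : realType) (N : nat) (f : 'rV[R]_N -> R) : Prop :=
  measurable_fun setT f /\ L1loc (fun x => (f x ^+ 2)%:E).

(* G is the distributional gradient of f, and both are in L^1_loc. *)
Definition weak_gradient (R : realType) (N : nat) (f : 'rV[R]_N -> R)
    (G : 'rV[R]_N -> 'rV[R]_N) : Prop :=
  [/\ L1loc (fun x => (f x)%:E),
      (forall i : 'I_N, L1loc (fun x => (G x ord0 i)%:E)) &
      forall (i : 'I_N) (psi : 'rV[R]_N -> R), test_function psi ->
        (\int[lebesgue_rV R N]_x (f x * gradient psi x ord0 i)%:E =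
         - \int[lebesgue_rV R N]_x (G x ord0 i * psi x)%:E)%E].

Definition H1loc (R : realType) (N : nat) (f : 'rV[R]_N -> R) : Prop :=
  L2loc f /\ exists G : 'rV[R]_N -> 'rV[R]_N,
    weak_gradient f G /\ forall i : 'I_N, L2loc (fun x => G x ord0 i).

(* H1mu mu u G: u is an element of H^1_mu and G is its gradient.  The
   completion of C_c^oo for the H^1_mu norm is realized as the closure of
   {(v, grad v) | v in C_c^oo} in L^2_mu x (L^2_mu)^N. *)
Definition H1mu (R : realType) (N : nat) (mu : 'rV[R]_N -> R)
    (u : 'rV[R]_N -> R) (G : 'rV[R]_N -> 'rV[R]_N) : Prop :=
  let leb := lebesgue_rV R N in
  [/\ measurable_fun setT u,
      measurable_fun setT G,
      (\int[leb]_x (u x ^+ 2 * mu x)%:E < +oo)%E,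
      (\int[leb]_x (sqnorm (G x) * mu x)%:E < +oo)%E &
      exists v : nat -> 'rV[R]_N -> R,
        [/\ forall m, test_function (v m),
            (\int[leb]_x ((v m x - u x) ^+ 2 * mu x)%:E)%E
              @[m --> \oo] --> 0%E &
            (\int[leb]_x (sqnorm (gradient (v m) x - G x) * mu x)%:E)%E
              @[m --> \oo] --> 0%E]].

(* gmu is the gradient of the weight mu.  The inverse of mu is taken in
   \bar R, where 0^-1 = +oo: with the convention 0^-1 = 0 of R, the last
   condition would not force mu > 0 almost everywhere. *)
Definition weight_regularity (R : realType) (N : nat) (mu : 'rV[R]_N -> R)
    (gmu : 'rV[R]_N -> 'rV[R]_N) : Prop :=
  [/\ weak_gradient mu gmu,
      H1loc (fun x => Num.sqrt (mu x)) &
      L1loc (fun x => ((mu x)%:E^-1)%E)].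

(* The quotients by sqnorm (x - a i) are 0 at the pole x = a i, a null set. *)
Definition weight_lower_bound (R : realType) (N n : nat) (a : 'I_n -> 'rV[R]_N)
    (beta k1 k2 : R) (mu : 'rV[R]_N -> R) (gmu : 'rV[R]_N -> 'rV[R]_N) : Prop :=
  {ae lebesgue_rV R N, forall x,
    (- k1 + \sum_(i < n) k2 * beta / sqnorm (x - a i)) * mu x <=
    beta * \sum_(i < n) dotv (x - a i) (gmu x) / sqnorm (x - a i)}.

Definition c_o (R : realType) (M : R) : R := ((M - 2) / 2) ^+ 2.

(* Main.v *)
(* With P the product of the |x - a_i|^2, the field S = sum_i (x - a_i)/|x - a_i|^2
   is half the gradient of ln P, and the field
   V = P/(P + eps) S is smooth on the whole space.  Testing the weak gradient of
   mu with v^2 V, v a test function, and completing the square in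
   |grad v + beta v S|^2 gives the inequality for v, with the cutoff P/(P + eps)
   in the weighted terms.  The derivative of the cutoff contributes a term
   proportional to |S|^2 >= 0, which is discarded, so no a priori integrability
   of v^2/|x - a_i|^2 is needed.  Finally
   |S|^2 = n sum_i 1/|x - a_i|^2
           - 1/2 sum_{i <> j} |a_i - a_j|^2/(|x - a_i|^2 |x - a_j|^2).
   For fixed eps, truncating the Hardy weight makes all weights bounded, so the
   inequality passes to the limit v -> phi in L^2_mu; monotone convergence then
   removes the cutoff and the truncation. *)

Require Import Defs.
From HB Require Import structures.
From mathcomp Require Import all_boot all_order all_algebra.
From mathcomp Require Import all_classical all_reals all_analysis.
From mathcomp Require Import measurable_realfun.
From mathcomp Require Import ring lra.

Set Implicit Arguments.
Unset Strict Implicit.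
Unset Printing Implicit Defensive.
Import Order.TTheory GRing.Theory Num.Theory.
Import numFieldNormedType.Exports.
Local Open Scope classical_set_scope.
Local Open Scope ring_scope.

(** * Measurability in R^N *)

Section measurability.
Context (R : realType) (N : nat).

Lemma measurable_coord_box (a b : 'I_N -> R) :
  measurable [set x : 'rV[R]_N | forall i, a i < x ord0 i < b i].
Proof.
rewrite (_ : [set _ | _] = \bigcap_(i in [set: 'I_N])
    ((fun x : 'rV[R]_N => (x ord0 i : measurableTypeR R)) @^-1` `]a i, b i[)).
  apply: fin_bigcap_measurable => // i _.
  by rewrite -[X in measurable X]setTI; apply: measurable_coord.
by apply/seteqP; split => x /= H i; have := H i; rewrite /= in_itv/=; exact.
Qed.

(** The sigma-algebra is generated by the coordinates and not by the topology. The two meet because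
    an open set is the countable union of the rational boxes that it contains. *)
Lemma open_rV_measurable (U : set 'rV[R]_N) : open U -> measurable U.
Proof.
move=> oU.
pose B (p : 'rV[rat]_N * 'rV[rat]_N) := [set x : 'rV[R]_N |
  forall i, ratr (p.1 ord0 i) < x ord0 i < ratr (p.2 ord0 i)].
have -> : U = \bigcup_p (if `[< B p `<=` U >] then B p else set0).
  apply/seteqP; split=> [x Ux|x [p _]]; last by case: asboolP => // H /H.
  have /nbhs_ballP[e /= e0 eU] : nbhs x U by exact: open_nbhs_nbhs.
  have lo i : exists q : rat, x ord0 i - e < ratr q < x ord0 i.
    have [|q] := @rat_in_itvoo R (x ord0 i - e) (x ord0 i); first by lra.
    by rewrite in_itv/=; exists q.
  have hi i : exists q : rat, x ord0 i < ratr q < x ord0 i + e.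
    have [|q] := @rat_in_itvoo R (x ord0 i) (x ord0 i + e); first by lra.
    by rewrite in_itv/=; exists q.
  have [l lP] := choice lo; have [h hP] := choice hi.
  exists (\row_i l i, \row_i h i) => //.
  case: asboolP => [_ i|nB]; first by
    rewrite !mxE; move: (lP i) (hP i) => /andP[_ ->] /andP[-> _].
  (* Balls of the sup norm are cubes, so a box whose sides stay within e of x lies in the ball. *)
  exfalso; apply: nB => y By; apply: eU; split => // i j; rewrite ord1 /ball/=.
  have := By j; rewrite !mxE => /andP[y1 y2].
  have /andP[l1 l2] := lP j; have /andP[h1 h2] := hP j.
  by rewrite ltr_norml; apply/andP; split; lra.
apply: countable_bigcupT_measurable => [|p]; first exact: countableP.
by case: asboolP => // _; exact: measurable_coord_box.
Qed.

Lemma continuous_rV_measurable (f : 'rV[R]_N -> R) :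
  continuous f -> measurable_fun setT f.
Proof.
move/continuousP => cf; apply: (measurability _ (RGenOpens.measurableE R)).
move=> _ [_ [a [b ->] <-]]; rewrite setTI; apply: open_rV_measurable.
exact/cf/interval_open.
Qed.

Lemma closed_rV_measurable (A : set 'rV[R]_N) : closed A -> measurable A.
Proof.
move=> cA; rewrite -[A]setCK; apply: measurableC; apply: open_rV_measurable.
exact: closed_openC.
Qed.

(** A point is a degenerate box, whose volume has a zero factor. In dimension 0 the measure is a
    Dirac mass, hence the condition on [N]. *)
Lemma lebesgue_rV_set1 (a : 'rV[R]_N) : (0 < N)%N -> lebesgue_rV R N [set a] = 0%E.
Proof.
move=> N0.
have E : [set a] = [set x : 'rV[R]_N | forall i, a ord0 i <= x ord0 i <= a ord0 i].
  apply/seteqP; split=> [x -> i|x/= xa]; first by rewrite lexx.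
  by apply/rowP => i; apply/eqP; rewrite eq_le andbC; exact: xa.
rewrite E (@lebesgue_rV_box R N (a ord0) (a ord0) (fun=> lexx _)).
by rewrite (bigD1 (Ordinal N0))//= subrr mul0r.
Qed.

Lemma measurable_rV_set1 (a : 'rV[R]_N) : measurable [set a].
Proof.
apply: closed_rV_measurable; apply: compact_closed; last exact: compact_set1.
exact: norm_hausdorff.
Qed.

End measurability.

(** On nonnegative reals the inverse is the power of exponent -1, which is measurable. Both take the
    value 0 at 0, so the zeros of [f] need no separate treatment. *)
Lemma measurable_ge0_inv d (T : measurableType d) (R : realType) (f : T -> R) :
  (forall x, 0 <= f x) -> measurable_fun setT f ->
  measurable_fun setT (fun x => (f x)^-1).
Proof.
move=> f0 mf; under eq_fun do rewrite -powR_inv1//.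
exact: (measurableT_comp (@measurable_powR R (-1)) mf).
Qed.

(** * Smooth functions *)

Section smooth_closure.
Context (R : realType) (N : nat).
Local Notation e_ := (@delta_mx R 1 N ord0).

Lemma is_derive_coord (i k : 'I_N) (x : 'rV[R]_N) :
  is_derive x (e_ i) (fun y : 'rV[R]_N => y ord0 k) (e_ i ord0 k).
Proof.
have lim : (fun h : R => h^-1 *: (((fun y : 'rV[R]_N => y ord0 k) \o shift x)
    (h *: e_ i) - x ord0 k)) @ 0^' --> e_ i ord0 k.
  apply: cvg_near_cst; near=> h.
  have h0 : h != 0 by near: h; exact: nbhs_dnbhs_neq.
  by rewrite /= 2!mxE addrK scalerA mulVf// scale1r.
apply: DeriveDef; last exact/cvg_lim.
by apply/cvg_ex; exists (e_ i ord0 k).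
Unshelve. all: by end_near. Qed.

Lemma is_derive_sumr I (r : seq I) (h : I -> 'rV[R]_N -> R) (dh : I -> R)
    (x v : 'rV[R]_N) :
  (forall i, is_derive x v (h i) (dh i)) ->
  is_derive x v (fun y => \sum_(i <- r) h i y) (\sum_(i <- r) dh i).
Proof.
move=> H; elim: r => [|i r IH].
  by under eq_fun do rewrite big_nil; rewrite big_nil; exact: is_derive_cst.
under eq_fun do rewrite big_cons.
by rewrite big_cons; exact: is_deriveD.
Qed.

Lemma is_deriveVr (f : 'rV[R]_N -> R) (x v : 'rV[R]_N) df : f x != 0 ->
  is_derive x v f df -> is_derive x v (fun y => (f y)^-1) (- df / f x ^+ 2).
Proof.
move=> fx0 [fd fE]; apply: DeriveDef; first exact: derivableV.
by rewrite deriveV// fE /GRing.scale/= mulNr mulrC mulNr.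
Qed.

Lemma is_deriveMr (f g : 'rV[R]_N -> R) (x v : 'rV[R]_N) df dg :
  is_derive x v f df -> is_derive x v g dg ->
  is_derive x v (fun y => f y * g y) (df * g x + f x * dg).
Proof.
by move=> Hf Hg; apply: is_derive_eq (is_deriveM Hf Hg) _;
  rewrite /GRing.scale/= addrC mulrC.
Qed.

Definition smooth (f : 'rV[R]_N -> R) := forall s : seq 'I_N,
  continuous (iter_partial s f) /\
  forall i x, derivable (iter_partial s f) x (e_ i).

(* An algebra of functions that is visibly stable under partial derivatives,
   all of whose members are therefore smooth. *)
Inductive smooth_expr : ('rV[R]_N -> R) -> Prop :=
| smooth_expr_base f : smooth f -> smooth_expr f
| smooth_expr_cst c : smooth_expr (fun=> c)
| smooth_expr_coord k : smooth_expr (fun x => x ord0 k)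
| smooth_expr_add f g : smooth_expr f -> smooth_expr g ->
    smooth_expr (fun x => f x + g x)
| smooth_expr_mul f g : smooth_expr f -> smooth_expr g ->
    smooth_expr (fun x => f x * g x)
| smooth_expr_inv f : (forall x, f x != 0) -> smooth_expr f ->
    smooth_expr (fun x => (f x)^-1).

(** The partial derivatives are found inside the algebra, which is what allows iteration along
    [iter_partial]. *)
Lemma smooth_expr_spec f : smooth_expr f -> continuous f /\
  forall i, exists2 df, smooth_expr df &
    forall x, is_derive x (e_ i) f (df x).
Proof.
elim=> {f} [f fs|c|k|f g _ [cf Df] _ [cg Dg]|f g sf [cf Df] sg [cg Dg]
  |f f0 sf [cf Df]].
- split=> [|i]; first by have [] := fs [::].
  exists ('D_(e_ i) f).
    (* [iter_partial] applies the last index of the list first, so the partials of D_i f are those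
       of f along [rcons s i]. *)
    apply: smooth_expr_base => s; have := fs (rcons s i).
    by rewrite /iter_partial foldr_rcons.
  by move=> x; apply/derivableP; have [_] := fs [::]; apply.
- split=> [|i]; first exact: cst_continuous.
  by exists (fun=> 0) => [|x]; [exact: smooth_expr_cst|exact: is_derive_cst].
- split=> [|i]; first exact: coord_continuous.
  exists (fun=> e_ i ord0 k) => [|x]; first exact: smooth_expr_cst.
  exact: is_derive_coord.
- split=> [x|i]; first exact: (cvgD (cf x) (cg x)).
  have [df sdf Hf] := Df i; have [dg sdg Hg] := Dg i.
  exists (fun x => df x + dg x) => [|x]; first exact: smooth_expr_add.
  exact: is_deriveD.
- split=> [x|i]; first exact: (cvgM (cf x) (cg x)).
  have [df sdf Hf] := Df i; have [dg sdg Hg] := Dg i.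
  exists (fun x => df x * g x + f x * dg x) => [|x]; last exact: is_deriveMr.
  by apply: smooth_expr_add; exact: smooth_expr_mul.
- split=> [x|i]; first exact: (cvgV (f0 x) (cf x)).
  have [df sdf Hf] := Df i.
  (* This is -f'/f^2, written with the constructors of [smooth_expr] only. *)
  exists (fun x => (-1 * df x) * ((f x)^-1 * (f x)^-1)) => [|x].
    apply: smooth_expr_mul; apply: smooth_expr_mul => //;
      [exact: smooth_expr_cst|exact: smooth_expr_inv|exact: smooth_expr_inv].
  rewrite mulN1r -invfM -expr2; exact: is_deriveVr.
Qed.

Lemma smooth_expr_smooth f : smooth_expr f -> smooth f.
Proof.
move=> sf s; suff : smooth_expr (iter_partial s f).
  move=> /smooth_expr_spec[cg Dg]; split => // i x.
  by have [dg _ /(_ x)[]] := Dg i.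
elim: s => //= i s /smooth_expr_spec[_ /(_ i)[dg sdg H]].
by rewrite (_ : 'D_ _ _ = dg)//; apply/funext => x; exact: derive_val.
Qed.

Lemma smooth_expr_sum I (r : seq I) (h : I -> 'rV[R]_N -> R) :
  (forall i, smooth_expr (h i)) -> smooth_expr (fun y => \sum_(i <- r) h i y).
Proof.
move=> H; elim: r => [|i r IH].
  by under eq_fun do rewrite big_nil; exact: smooth_expr_cst.
by under eq_fun do rewrite big_cons; exact: smooth_expr_add.
Qed.

Lemma smooth_expr_prod I (r : seq I) (P : pred I) (h : I -> 'rV[R]_N -> R) :
  (forall i, smooth_expr (h i)) ->
  smooth_expr (fun y => \prod_(i <- r | P i) h i y).
Proof.
move=> H; elim: r => [|i r IH].
  by under eq_fun do rewrite big_nil; exact: smooth_expr_cst.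
under eq_fun do rewrite big_cons; case: (P i) => //; exact: smooth_expr_mul.
Qed.

Lemma test_function_mul (f g : 'rV[R]_N -> R) : test_function f ->
  smooth g -> test_function (fun x => f x * g x).
Proof.
move=> [sf kf] sg; split.
  by apply: smooth_expr_smooth; apply: smooth_expr_mul; exact: smooth_expr_base.
apply: subclosed_compact kf _; first exact: closed_closure.
by apply: closureS => x /=; apply: contra_neq => ->; rewrite mul0r.
Qed.

(** The complement of the closed support is open, so f is zero near x and its derivatives vanish
    too. Integrands built from f or its gradient thus live on a compact set. *)
Lemma test_function_vanish (f : 'rV[R]_N -> R) x :
  ~ closure [set x | f x != 0] x ->
  f x = 0 /\ gradient f x = 0.
Proof.
move=> nx; have nf : \forall y \near x, f y = 0.
  have : nbhs x (~` closure [set x | f x != 0]).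
    by apply: open_nbhs_nbhs; split => //; apply: closed_openC; exact: closed_closure.
  apply: filterS => y ny; apply: contra_notP ny => /eqP fy.
  exact: subset_closure.
split; first exact: nbhs_singleton nf.
apply/rowP => i; rewrite !mxE.
suff [] : is_derive x (e_ i) f 0 by [].
apply: (@near_eq_is_derive _ _ _ (cst 0)) (is_derive_cst 0 x _).
by apply: filterS nf => y ->.
Qed.

End smooth_closure.

(** * The multipolar field *)

Section dot_product.
Context (R : realType) (N : nat).
Implicit Types u v w : 'rV[R]_N.

Lemma dotvC u v : dotv u v = dotv v u.
Proof. by apply: eq_bigr => k _; rewrite mulrC. Qed.

Lemma dotvDr u v w : dotv u (v + w) = dotv u v + dotv u w.
Proof. by rewrite -big_split; apply: eq_bigr => k _; rewrite mxE mulrDr. Qed.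

Lemma dotvZr c u v : dotv u (c *: v) = c * dotv u v.
Proof. by rewrite /dotv mulr_sumr; apply: eq_bigr => k _; rewrite mxE mulrCA. Qed.

Lemma dotv_sumr I (r : seq I) u (F : I -> 'rV[R]_N) :
  dotv u (\sum_(i <- r) F i) = \sum_(i <- r) dotv u (F i).
Proof.
elim: r => [|i r IH]; last by rewrite !big_cons dotvDr IH.
by rewrite !big_nil /dotv big1// => k _; rewrite mxE mulr0.
Qed.

Lemma sqnorm_ge0 u : 0 <= sqnorm u.
Proof. by apply: sumr_ge0 => k _; rewrite -expr2 sqr_ge0. Qed.

Lemma sqnormD u v : sqnorm (u + v) = sqnorm u + 2 * dotv u v + sqnorm v.
Proof.
rewrite /sqnorm /dotv mulr_sumr -!big_split; apply: eq_bigr => k _.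
by rewrite mxE /=; ring.
Qed.

Lemma sqnormZ c u : sqnorm (c *: u) = c ^+ 2 * sqnorm u.
Proof. by rewrite /sqnorm /dotv mulr_sumr; apply: eq_bigr => k _; rewrite mxE; ring. Qed.

Lemma sqnorm0 : sqnorm (0 : 'rV[R]_N) = 0.
Proof. by rewrite -[0](scale0r 0) sqnormZ expr2 !mul0r. Qed.

Lemma sqnorm_eq0 u : (sqnorm u == 0) = (u == 0).
Proof.
apply/eqP/eqP => [/eqP|->]; last exact: sqnorm0.
rewrite psumr_eq0 => [/allP u0|k _]; last by rewrite -expr2 sqr_ge0.
apply/rowP => k; have := u0 k (mem_index_enum k).
by rewrite mxE -expr2 sqrf_eq0 => /eqP.
Qed.

End dot_product.

Section multipolar_field.
Context (R : realType) (N n : nat) (a : 'I_n -> 'rV[R]_N).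
Implicit Types (x : 'rV[R]_N) (eps : R) (k : 'I_N) (i : 'I_n).

Definition pole_dist2 i x := sqnorm (x - a i).

Definition pole_sum x := \sum_(i < n) (pole_dist2 i x)^-1.

Definition pole_interaction x := \sum_(i < n) \sum_(j < n | i != j)
  sqnorm (a i - a j) / (pole_dist2 i x * pole_dist2 j x).

Definition pole_field x : 'rV[R]_N :=
  \sum_(i < n) (pole_dist2 i x)^-1 *: (x - a i).

Definition pole_prod x := \prod_(i < n) pole_dist2 i x.

(* The gradient of [ln (pole_prod x)] is [2 *: pole_field x], so the gradient
   of this cutoff is a nonnegative multiple of [pole_field x]. *)
Definition pole_cutoff (eps : R) x := pole_prod x / (pole_prod x + eps).

Lemma pole_dist2_ge0 i x : 0 <= pole_dist2 i x.
Proof. exact: sqnorm_ge0. Qed.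

Lemma pole_sum_ge0 x : 0 <= pole_sum x.
Proof. by apply: sumr_ge0 => i _; rewrite invr_ge0 pole_dist2_ge0. Qed.

Lemma pole_interaction_ge0 x : 0 <= pole_interaction x.
Proof.
apply: sumr_ge0 => i _; apply: sumr_ge0 => j _.
by rewrite divr_ge0 ?mulr_ge0 ?pole_dist2_ge0 ?sqnorm_ge0.
Qed.

Lemma pole_prod_ge0 x : 0 <= pole_prod x.
Proof. by apply: prodr_ge0 => i _; exact: pole_dist2_ge0. Qed.

Lemma pole_prod_gt0 x : (forall i, x != a i) -> 0 < pole_prod x.
Proof.
move=> xa; apply: prodr_gt0 => i _; rewrite lt0r pole_dist2_ge0 andbT.
by rewrite sqnorm_eq0 subr_eq0.
Qed.

Lemma pole_cutoff_ge0 eps x : 0 < eps -> 0 <= pole_cutoff eps x.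
Proof.
by move=> e0; rewrite divr_ge0 ?addr_ge0 ?pole_prod_ge0// ltW.
Qed.

Lemma pole_cutoff_le1 eps x : 0 < eps -> pole_cutoff eps x <= 1.
Proof.
move=> e0; have P0 := pole_prod_ge0 x.
by rewrite ler_pdivrMr ?mul1r; lra.
Qed.

Lemma pole_cutoff_nincr (e1 e2 : R) x : 0 < e1 -> e1 <= e2 ->
  pole_cutoff e2 x <= pole_cutoff e1 x.
Proof.
move=> e0 e12; have P0 := pole_prod_ge0 x.
by rewrite ler_wpM2l// lef_pV2 ?posrE; lra.
Qed.

(** Since a_i - a_j = (x - a_j) - (x - a_i), expanding |a_i - a_j|^2 and dividing by |x - a_i|^2 |x
    - a_j|^2 gives 1/|x - a_i|^2 + 1/|x - a_j|^2 minus twice the (i, j) term of |S|^2. Summing over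
    all pairs gives the identity. *)
Lemma pole_field_sqnorm x : (forall i, x != a i) ->
  sqnorm (pole_field x) = n%:R * pole_sum x - pole_interaction x / 2.
Proof.
move=> xa; have q0 i : pole_dist2 i x != 0 by rewrite sqnorm_eq0 subr_eq0.
have -> : pole_interaction x = \sum_(i < n) \sum_(j < n)
    ((pole_dist2 i x)^-1 + (pole_dist2 j x)^-1 -
     2 * ((pole_dist2 i x)^-1 * ((pole_dist2 j x)^-1 *
            dotv (x - a i) (x - a j)))).
  apply: eq_bigr => i _; rewrite big_mkcond; apply: eq_bigr => j _.
  (* The diagonal terms are zero, so the sum extends to all pairs. *)
  have -> : (if i != j then sqnorm (a i - a j) / (pole_dist2 i x * pole_dist2 j x)
     else 0) = sqnorm (a i - a j) / (pole_dist2 i x * pole_dist2 j x).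
    by case: eqVneq => // ->; rewrite subrr sqnorm0 mul0r.
  have -> : a i - a j = (x - a j) + (-1) *: (x - a i).
    by rewrite scaleN1r; apply/rowP => k; rewrite !mxE; ring.
  rewrite sqnormD sqnormZ dotvZr -/(pole_dist2 i x) -/(pole_dist2 j x) dotvC.
  have := q0 i; have := q0 j; move: (pole_dist2 i x) (pole_dist2 j x) => p q pq qq.
  by field; rewrite pq qq.
have -> : sqnorm (pole_field x) = \sum_(i < n) \sum_(j < n)
    (pole_dist2 i x)^-1 * ((pole_dist2 j x)^-1 * dotv (x - a i) (x - a j)).
  rewrite /sqnorm {2}/pole_field dotv_sumr; apply: eq_bigr => i _.
  rewrite dotvZr dotvC /pole_field dotv_sumr mulr_sumr; apply: eq_bigr => j _.
  by rewrite dotvZr.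
under [in RHS]eq_bigr do rewrite sumrB big_split/= -mulr_sumr.
rewrite sumrB big_split/= -mulr_sumr.
rewrite -/(pole_sum x) sumr_const card_ord -mulr_natl.
under [X in _ - (X + _ - _) / _]eq_bigr do rewrite sumr_const card_ord -mulr_natl.
by rewrite -mulr_sumr -/(pole_sum x); field.
Qed.

(** * Derivatives of the field and of its cutoff *)

Local Notation e_ := (@delta_mx R 1 N ord0).

Lemma is_derive_coordB (y x : 'rV[R]_N) l k :
  is_derive x (e_ l) (fun z : 'rV[R]_N => z ord0 k - y ord0 k) ((k == l)%:R).
Proof.
apply: is_derive_eq
  (is_deriveB (is_derive_coord l k x) (is_derive_cst (y ord0 k) x (e_ l))) _.
by rewrite mxE eqxx subr0.
Qed.

Lemma is_derive_pole_dist2 i k x :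
  is_derive x (e_ k) (pole_dist2 i) (2 * (x ord0 k - a i ord0 k)).
Proof.
have -> : pole_dist2 i = fun z => \sum_(l < N)
    (z ord0 l - a i ord0 l) * (z ord0 l - a i ord0 l).
  by apply/funext => z; apply: eq_bigr => l _; rewrite !mxE.
have D l := is_derive_coordB (a i) x k l.
apply: is_derive_eq (is_derive_sumr _ (fun l => is_deriveMr (D l) (D l))) _.
rewrite (bigD1 k)//= eqxx big1 ?addr0; last first.
  by move=> l /negbTE ->; rewrite mul0r mulr0 addr0.
by rewrite mul1r mulr1 mulr2n mulrDl !mul1r.
Qed.

(** Logarithmic differentiation: each factor contributes 2 (x - a_i)/|x - a_i|^2. The induction runs
    over an arbitrary list of poles. *)
Lemma is_derive_pole_prod k x : (forall i, x != a i) ->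
  is_derive x (e_ k) pole_prod (2 * pole_prod x * pole_field x ord0 k).
Proof.
move=> xa; have q0 i : pole_dist2 i x != 0 by rewrite sqnorm_eq0 subr_eq0.
rewrite /pole_prod /pole_field summxE; elim: (index_enum _) => [|i r IH].
  rewrite !big_nil mulr0; under eq_fun do rewrite big_nil.
  exact: is_derive_cst.
under eq_fun do rewrite big_cons; rewrite !big_cons.
apply: is_derive_eq (is_deriveMr (is_derive_pole_dist2 i k x) IH) _.
rewrite !mxE; set p := \prod_(_ <- r) _; set t := \sum_(_ <- r) _.
by have := q0 i; move: (pole_dist2 i x) => q qi; field.
Qed.

Lemma is_derive_pole_field k x : (forall i, x != a i) ->
  is_derive x (e_ k) (fun y => pole_field y ord0 k)
    (\sum_(i < n) ((pole_dist2 i x)^-1 -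
       2 * (x ord0 k - a i ord0 k) ^+ 2 / pole_dist2 i x ^+ 2)).
Proof.
move=> xa; have q0 i : pole_dist2 i x != 0 by rewrite sqnorm_eq0 subr_eq0.
have -> : (fun y => pole_field y ord0 k) = fun y => \sum_(i < n)
    (pole_dist2 i y)^-1 * (y ord0 k - a i ord0 k).
  by apply/funext => y; rewrite summxE; apply: eq_bigr => i _; rewrite !mxE.
apply: is_derive_sumr => i.
apply: is_derive_eq (is_deriveMr (is_deriveVr (q0 i) (is_derive_pole_dist2 i k x))
  (is_derive_coordB (a i) x k k)) _.
by rewrite eqxx /=; field.
Qed.

Lemma is_derive_pole_cutoff eps k x : 0 < eps -> (forall i, x != a i) ->
  is_derive x (e_ k) (pole_cutoff eps)
    (2 * eps * pole_prod x / (pole_prod x + eps) ^+ 2 * pole_field x ord0 k).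
Proof.
move=> e0 xa; have P0 := pole_prod_ge0 x.
have PE0 : pole_prod x + eps != 0 by rewrite gt_eqF//; lra.
have DP := is_derive_pole_prod k xa.
have DPe : is_derive x (e_ k) (fun y => pole_prod y + eps) _ :=
  is_deriveD DP (is_derive_cst eps x (e_ k)).
apply: is_derive_eq (is_deriveMr DP (is_deriveVr PE0 DPe)) _.
by field.
Qed.

(** Component k of the regularized field V, kept scalar so that [smooth] applies to it. *)
Definition cut_field eps k x := pole_cutoff eps x * pole_field x ord0 k.

(* Multiplying by the cutoff clears the denominators. *)
Lemma cut_fieldE eps k : cut_field eps k =
  fun x => (\sum_(i < n) (x ord0 k - a i ord0 k) *
    \prod_(j < n | j != i) pole_dist2 j x) * (pole_prod x + eps)^-1.
Proof.
apply/funext => x; rewrite /cut_field /pole_cutoff mulrAC; congr (_ * _).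
rewrite summxE mulr_sumr; apply: eq_bigr => i _.
rewrite !mxE /pole_prod (bigD1 i)//=.
(* At the pole a_i the left side is 0 because 0^-1 = 0, and the right side because the factor x_k -
   (a_i)_k vanishes. *)
have [xi|qi] := eqVneq (pole_dist2 i x) 0; last by field.
move/eqP: (xi); rewrite sqnorm_eq0 => /eqP/rowP/(_ k); rewrite !mxE => ->.
by rewrite !mulr0 mul0r.
Qed.

(** * Smoothness and divergence of the regularized field *)

Lemma smooth_expr_pole_dist2 i : smooth_expr (pole_dist2 i).
Proof.
have -> : pole_dist2 i = fun z => \sum_(l < N)
    (z ord0 l + - a i ord0 l) * (z ord0 l + - a i ord0 l).
  by apply/funext => z; apply: eq_bigr => l _; rewrite !mxE.
apply: smooth_expr_sum => l; apply: smooth_expr_mul; apply: smooth_expr_add;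
  by [exact: smooth_expr_coord|exact: smooth_expr_cst].
Qed.

Lemma smooth_expr_pole_denom eps : 0 < eps ->
  smooth_expr (fun x => (pole_prod x + eps)^-1).
Proof.
move=> e0; apply: smooth_expr_inv => [x|].
  by rewrite gt_eqF// ltr_wpDl ?pole_prod_ge0.
apply: smooth_expr_add; last exact: smooth_expr_cst.
by apply: smooth_expr_prod => i; exact: smooth_expr_pole_dist2.
Qed.

Lemma smooth_pole_cutoff eps : 0 < eps -> smooth (pole_cutoff eps).
Proof.
move=> e0; apply: smooth_expr_smooth; apply: smooth_expr_mul.
  by apply: smooth_expr_prod => i; exact: smooth_expr_pole_dist2.
exact: smooth_expr_pole_denom.
Qed.

Lemma smooth_cut_field eps k : 0 < eps -> smooth (cut_field eps k).
Proof.
move=> e0; rewrite cut_fieldE; apply: smooth_expr_smooth.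
apply: smooth_expr_mul; last exact: smooth_expr_pole_denom.
apply: smooth_expr_sum => i; apply: smooth_expr_mul.
  by apply: smooth_expr_add; [exact: smooth_expr_coord|exact: smooth_expr_cst].
by apply: smooth_expr_prod => j; exact: smooth_expr_pole_dist2.
Qed.

(** Product rule: the gradient of the cutoff is a multiple of S, which produces the |S|^2 term, and
    div S = (N - 2) sum_i 1/|x - a_i|^2. *)
Lemma cut_field_divergence eps x : 0 < eps -> (forall i, x != a i) ->
  \sum_(k < N) 'D_(e_ k) (cut_field eps k) x =
  2 * eps * pole_prod x / (pole_prod x + eps) ^+ 2 * sqnorm (pole_field x) +
  pole_cutoff eps x * (N%:R - 2) * pole_sum x.
Proof.
move=> e0 xa; have q0 i : pole_dist2 i x != 0 by rewrite sqnorm_eq0 subr_eq0.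
have E k : 'D_(e_ k) (cut_field eps k) x = _ := @derive_val _ _ _ _ _ _ _
  (is_deriveMr (is_derive_pole_cutoff k e0 xa) (is_derive_pole_field k xa)).
under eq_bigr do rewrite E.
rewrite big_split/=; congr (_ + _).
  by rewrite /sqnorm /dotv mulr_sumr; apply: eq_bigr => k _; rewrite mulrA.
(* Summing over coordinates first, each pole gives N/|x - a_i|^2 - 2 |x - a_i|^2/|x - a_i|^4. *)
rewrite -mulr_sumr exchange_big/= -mulrA; congr (_ * _).
rewrite /pole_sum mulr_sumr; apply: eq_bigr => i _.
rewrite sumrB sumr_const card_ord -[_ *+ N]mulr_natl mulrBl; congr (_ - _).
under eq_bigr do rewrite -mulrA.
rewrite -mulr_sumr; congr (_ * _); rewrite -mulr_suml.
have -> : \sum_(k < N) (x ord0 k - a i ord0 k) ^+ 2 = pole_dist2 i x.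
  by apply: eq_bigr => k _; rewrite !mxE expr2.
by field.
Qed.

End multipolar_field.

(** * Convergence of integrals *)

Section integral_limits.
Context d (T : measurableType d) (R : realType).
Variable nu : {measure set T -> \bar R}.
Local Notation integrableR f := (nu.-integrable setT (EFin \o f)).

Lemma EFin_integrableD (f g : T -> R) : integrableR f -> integrableR g ->
  integrableR (fun x => f x + g x).
Proof. by move=> fi gi; exact: (integrableD measurableT fi gi). Qed.

Lemma EFin_integrableB (f g : T -> R) : integrableR f -> integrableR g ->
  integrableR (fun x => f x - g x).
Proof. by move=> fi gi; exact: (integrableB measurableT fi gi). Qed.

Lemma EFin_integrableZl (c : R) (f : T -> R) : integrableR f ->
  integrableR (fun x => c * f x).
Proof. by move=> fi; exact: (integrableZl measurableT c fi). Qed.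

Lemma dominated_integrable (f g : T -> R) : measurable_fun setT f ->
  (forall x, `|f x| <= g x) -> integrableR g -> integrableR f.
Proof.
move=> mf fg; apply: le_integrable => //; first exact/measurable_EFinP.
by move=> x _ /=; rewrite lee_fin (le_trans (fg x))// ler_norm.
Qed.

Lemma le_ae_Rintegral (f g : T -> R) : integrableR f -> integrableR g ->
  {ae nu, forall x, f x <= g x} -> \int[nu]_x f x <= \int[nu]_x g x.
Proof.
move=> iff ig [Z [mZ nuZ fgZ]].
apply: fine_le; [exact: integrable_fin_num|exact: integrable_fin_num|].
rewrite (negligible_integral mZ _ iff nuZ)// (negligible_integral mZ _ ig nuZ)//.
have mTZ : measurable (setT `\` Z) by exact: measurableD.
apply: le_integral => //.
- exact: (@integrableS _ _ _ nu setT).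
- exact: (@integrableS _ _ _ nu setT).
by move=> x /set_mem[_ nZ]; rewrite lee_fin; move/subsetCl : fgZ; exact.
Qed.

Lemma EFin_integrable_sum I (r : seq I) (f : I -> T -> R) :
  (forall i, integrableR (f i)) -> integrableR (fun x => \sum_(i <- r) f i x).
Proof.
move=> fi; elim: r => [|i r IH].
  by under [X in EFin \o X]eq_fun do rewrite big_nil; exact: integrable0.
under [X in EFin \o X]eq_fun do rewrite big_cons.
exact: EFin_integrableD (fi i) IH.
Qed.

Lemma Rintegral_sum I (r : seq I) (f : I -> T -> R) :
  (forall i, integrableR (f i)) ->
  \int[nu]_x (\sum_(i <- r) f i x) = \sum_(i <- r) \int[nu]_x f i x.
Proof.
move=> fi; elim: r => [|i r IH].
  by under eq_Rintegral do rewrite big_nil; rewrite big_nil Rintegral_cst// mul0r.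
under eq_Rintegral do rewrite big_cons.
by rewrite RintegralD ?big_cons ?IH//; exact: EFin_integrable_sum.
Qed.

(* [ |v^2 - u^2| <= d u^2 + (1 + 1/d) (v - u)^2 ] for every [d > 0]. *)
Lemma cvg_weighted_square (m w u : T -> R) (v : nat -> T -> R) (M : R) :
  0 <= M -> (forall x, 0 <= m x) -> measurable_fun setT m ->
  (forall x, 0 <= w x <= M) -> measurable_fun setT w ->
  measurable_fun setT u -> (forall j, measurable_fun setT (v j)) ->
  integrableR (fun x => u x ^+ 2 * m x) ->
  (forall j, integrableR (fun x => v j x ^+ 2 * m x)) ->
  (\int[nu]_x ((v j x - u x) ^+ 2 * m x)%:E)%E @[j --> \oo] --> 0%E ->
  \int[nu]_x (w x * (v j x ^+ 2 * m x)) @[j --> \oo] -->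
  \int[nu]_x (w x * (u x ^+ 2 * m x)).
Proof.
move=> M0 m0 mm wM mw mu_ mv iu iv cv.
have iw (f : T -> R) : measurable_fun setT f -> integrableR (fun x => f x ^+ 2 * m x) ->
    integrableR (fun x => w x * (f x ^+ 2 * m x)).
  move=> mf if2; apply: (@dominated_integrable _ (fun x => M * (f x ^+ 2 * m x))).
  - apply: measurable_funM => //; apply: measurable_funM => //.
    exact: measurable_funX.
  - move=> x; have /andP[w0 wM0] := wM x.
    have f0 : 0 <= f x ^+ 2 * m x by rewrite mulr_ge0 ?sqr_ge0.
    rewrite /= ger0_norm; last by apply: mulr_ge0. exact: ler_wpM2r.
  - exact: (EFin_integrableZl M if2).
have idv j : integrableR (fun x => (v j x - u x) ^+ 2 * m x).
  apply: (@dominated_integrable _ (fun x => 2 * (v j x ^+ 2 * m x) +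
      2 * (u x ^+ 2 * m x))).
  - apply: measurable_funM => //; apply: measurable_funX.
    exact: measurable_funB.
  - move=> x; rewrite /= ger0_norm; last by apply: mulr_ge0; [exact: sqr_ge0|].
    rewrite !mulrA -mulrDl ler_wpM2r// -subr_ge0.
    (* Parallelogram identity: 2 v^2 + 2 u^2 - (v - u)^2 = (v + u)^2. *)
    rewrite (_ : _ - _ = (v j x + u x) ^+ 2) ?sqr_ge0//; ring.
  - exact: (EFin_integrableD (EFin_integrableZl 2 (iv j)) (EFin_integrableZl 2 iu)).
pose U := \int[nu]_x (u x ^+ 2 * m x).
pose E j := \int[nu]_x ((v j x - u x) ^+ 2 * m x).
have U0 : 0 <= U by apply: Rintegral_ge0 => x _; rewrite mulr_ge0 ?sqr_ge0.
have cE : E j @[j --> \oo] --> 0 by exact: (fine_cvg cv).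
have bound j dl : 0 < dl ->
    `|\int[nu]_x (w x * (v j x ^+ 2 * m x)) -
      \int[nu]_x (w x * (u x ^+ 2 * m x))| <=
    M * dl * U + M * (1 + dl^-1) * E j.
  move=> d0; have iwv := iw _ (mv j) (iv j); have iwu := iw _ mu_ iu.
  rewrite -RintegralB//; apply: le_trans (le_normr_Rintegral _ _) _ => //.
    exact: (EFin_integrableB iwv iwu).
  rewrite -!RintegralZl// -RintegralD//; last 2 first.
  - exact: (EFin_integrableZl (M * dl) iu).
  - exact: (EFin_integrableZl (M * (1 + dl^-1)) (idv j)).
  apply: le_Rintegral => //.
  - exact: (integrable_norm (EFin_integrableB iwv iwu)).
  - exact: (EFin_integrableD (EFin_integrableZl (M * dl) iu)
      (EFin_integrableZl (M * (1 + dl^-1)) (idv j))).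
  move=> x _; have /andP[w0 wM0] := wM x.
  rewrite -mulrBr normrM (ger0_norm w0) -mulrBl normrM (ger0_norm (m0 x)).
  rewrite -!mulrA -mulrDr !mulrA -!mulrDl mulrA.
  apply: ler_wpM2r => //; apply: ler_pM => //.
  set s := u x; set t := v j x - s.
  have -> : v j x = s + t by rewrite /t addrC subrK.
  have -> : (s + t) ^+ 2 - s ^+ 2 = 2 * s * t + t ^+ 2 by ring.
  (* Young's inequality: the two differences are (dl s + p)^2/dl and (dl s - p)^2/dl. *)
  have key p : `|2 * s * p| <= dl * s ^+ 2 + dl^-1 * p ^+ 2.
    have dn0 : dl != 0 by rewrite gt_eqF.
    have di : 0 <= dl^-1 by rewrite invr_ge0 ltW.
    rewrite ler_norml -subr_ge0 -[X in _ && X]subr_ge0.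
    have -> : 2 * s * p - - (dl * s ^+ 2 + dl^-1 * p ^+ 2) =
      dl^-1 * (dl * s + p) ^+ 2 by field.
    have -> : dl * s ^+ 2 + dl^-1 * p ^+ 2 - 2 * s * p =
      dl^-1 * (dl * s - p) ^+ 2 by field.
    by rewrite (mulr_ge0 di (sqr_ge0 _)) (mulr_ge0 di (sqr_ge0 _)).
  have := key t; have := sqr_ge0 t; rewrite !ler_norml => t0 /andP[k1 k2].
  by apply/andP; split; lra.
apply/cvgrPdist_le => /= e e0.
(* This choice makes the first term of [bound] at most e/2; [e1] does the same for the second once
   [dl] is fixed. The + 1 keeps the denominators positive. *)
pose dl := e / (2 * (M * U + 1)).
have MU : 0 < M * U + 1 by rewrite ltr_wpDl// mulr_ge0.
have d0 : 0 < dl by rewrite divr_gt0// mulr_gt0.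
have c0 : 0 <= M * (1 + dl^-1) by rewrite mulr_ge0// addr_ge0// invr_ge0 ltW.
have e1 : 0 < e / (2 * (M * (1 + dl^-1) + 1)).
  by rewrite divr_gt0// mulr_gt0// ltr_wpDl.
move/cvgrPdist_le: cE => /(_ _ e1) /=; apply: filterS => j.
rewrite sub0r normrN => Ej; rewrite distrC; apply: le_trans (bound j _ d0) _.
have {}Ej := le_trans (ler_norm _) Ej.
have h1 : M * dl * U <= e / 2.
  have -> : M * dl * U = (e / 2) * ((M * U) / (M * U + 1)).
    by rewrite /dl; field; rewrite gt_eqF.
  by rewrite ler_piMr ?divr_ge0 ?ltW// ltr_pdivrMr// mul1r ltrDl.
have h2 : M * (1 + dl^-1) * E j <= e / 2.
  apply: le_trans (ler_wpM2l c0 Ej) _.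
  have -> : M * (1 + dl^-1) * (e / (2 * (M * (1 + dl^-1) + 1))) =
      (e / 2) * ((M * (1 + dl^-1)) / (M * (1 + dl^-1) + 1)).
    have : M * (1 + dl^-1) + 1 != 0 by rewrite gt_eqF// ltr_wpDl.
    by move: (M * _) => c c1; field.
  by rewrite ler_piMr ?divr_ge0 ?ltW// ltr_pdivrMr ?mul1r ?ltrDl// ltr_wpDl.
by rewrite [e]splitr lerD.
Qed.

(** The limit is identified only off a null set, because the cutoffs are 0 at the poles for every
    index and do not tend to 1 there. *)
Lemma cvg_ae_monotone_convergence (Z : set T) (g : nat -> T -> \bar R)
    (f : T -> \bar R) :
  measurable Z -> nu Z = 0%E ->
  (forall j, measurable_fun setT (g j)) -> (forall j x, 0 <= g j x)%E ->
  (forall x, nondecreasing_seq (g^~ x)) ->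
  measurable_fun setT f -> (forall x, 0 <= f x)%E ->
  (forall x, ~ Z x -> g j x @[j --> \oo] --> f x) ->
  (\int[nu]_x g j x)%E @[j --> \oo] --> (\int[nu]_x f x)%E.
Proof.
move=> mZ nuZ mg g0 ndg mf f0 gf.
rewrite (ge0_negligible_integral mZ _ mf _ nuZ)//.
under eq_fun do rewrite (ge0_negligible_integral mZ _ (mg _) _ nuZ)//.
have -> : (\int[nu]_(x in setT `\` Z) f x =
    \int[nu]_(x in setT `\` Z) limn (g^~ x))%E.
  by apply: eq_integral => x /set_mem[_ nZ]; exact/esym/cvg_lim/gf.
apply: cvg_monotone_convergence => //; first exact: measurableD.
by move=> j; exact: measurable_funS (mg j).
Qed.

End integral_limits.

(** * The inequality for test functions *)

Section test_function_integrals.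
Context (R : realType) (N : nat).
Local Notation leb := (lebesgue_rV R N).

(** The integral reduces to K, where |g| attains a maximum; the product is then dominated by a
    multiple of f, which is integrable on K. *)
Lemma L1locM_integrable (f g : 'rV[R]_N -> R) (K : set 'rV[R]_N) :
  L1loc (fun x => (f x)%:E) -> continuous g -> compact K ->
  (forall x, ~ K x -> g x = 0) ->
  leb.-integrable setT (fun x => (f x * g x)%:E).
Proof.
move=> [mf fK] cg cK g0.
have mK : measurable K.
  by apply: closed_rV_measurable; apply: compact_closed => //; exact: norm_hausdorff.
have mg := continuous_rV_measurable cg.
have -> : (fun x => (f x * g x)%:E) = (fun x => (f x * g x)%:E) \_ K.
  apply/funext => x; rewrite patchE; case: ifPn => // /negP xK.
  by rewrite g0 ?mulr0// => Kx; apply: xK; rewrite inE.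
apply/(integrable_mkcond _ mK).
(* The extreme value theorem requires a nonempty K. *)
have [K0|/set0P K0] := eqVneq K set0.
  by rewrite K0; exact: integrable_set0.
have cng : {within K, continuous (fun x => `|g x|)}.
  by apply: continuous_subspaceT => x; exact: (cvg_norm (cg x)).
have [c _ gc] := EVT_max_rV K0 cK cng.
have cfK : leb.-integrable K (fun x => (`|g c|)%:E * (f x)%:E)%E.
  exact: integrableZl (fK _ cK).
apply: le_integrable cfK => //.
  apply/measurable_EFinP; apply: measurable_funTS; apply: measurable_funM => //.
  exact/measurable_EFinP.
move=> x Kx; rewrite /= lee_fin !normrM normr_id mulrC ler_wpM2r//.
by apply: gc; rewrite inE.
Qed.

Lemma test_function_continuous (f : 'rV[R]_N -> R) :
  test_function f -> continuous f.
Proof. by move=> [sf _]; have [] := sf [::]. Qed.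

Lemma gradient_continuous (f : 'rV[R]_N -> R) k :
  test_function f -> continuous (fun x => gradient f x ord0 k).
Proof.
move=> [sf _]; have [c _] := sf [:: k].
by rewrite (_ : (fun _ => _) = iter_partial [:: k] f)//; apply/funext => x; rewrite mxE.
Qed.

Lemma L1loc_test_integrable (f psi : 'rV[R]_N -> R) :
  L1loc (fun x => (f x)%:E) -> test_function psi ->
  leb.-integrable setT (fun x => (f x * psi x)%:E).
Proof.
move=> lf tpsi; apply: (L1locM_integrable lf (test_function_continuous tpsi) tpsi.2).
by move=> x /test_function_vanish[].
Qed.

Lemma L1loc_gradient_integrable (f psi : 'rV[R]_N -> R) k :
  L1loc (fun x => (f x)%:E) -> test_function psi ->
  leb.-integrable setT (fun x => (f x * gradient psi x ord0 k)%:E).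
Proof.
move=> lf tpsi; apply: (L1locM_integrable lf (gradient_continuous tpsi) tpsi.2).
by move=> x /test_function_vanish[_ ->]; rewrite mxE.
Qed.

(** Integration by parts is put in the form of one integrable function with zero integral, which can
    be added to a pointwise inequality before integrating. *)
Lemma weak_gradient_Rintegral (f psi : 'rV[R]_N -> R) G k :
  weak_gradient f G -> test_function psi ->
  let h x := f x * gradient psi x ord0 k + G x ord0 k * psi x in
  leb.-integrable setT (EFin \o h) /\ \int[leb]_x h x = 0.
Proof.
move=> [lf lG wf] tpsi h.
have i1 := L1loc_gradient_integrable k lf tpsi.
have i2 := L1loc_test_integrable (lG k) tpsi.
split; first exact: (EFin_integrableD i1 i2).
by rewrite RintegralD// {1}/Rintegral wf// fineN addNr.
Qed.

End test_function_integrals.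

Section test_function_inequality.
Context (R : realType) (N n : nat) (a : 'I_n -> 'rV[R]_N).
Context (beta k1 k2 : R) (mu : 'rV[R]_N -> R) (gmu : 'rV[R]_N -> 'rV[R]_N).
Hypotheses (N_gt0 : (0 < N)%N) (n_gt0 : (0 < n)%N) (beta_gt0 : 0 < beta).
Hypothesis mu_ge0 : forall x, 0 <= mu x.
Hypothesis mu_grad : weak_gradient mu gmu.
(** The vector field method yields the constant beta (N - 2 + k2) - n beta^2 in front of the Hardy
    term; this beta is its maximizer. *)
Hypothesis betaE : beta = (N%:R + k2 - 2) / (2 * n%:R).
Hypothesis mu_lb : weight_lower_bound a beta k1 k2 mu gmu.
Local Notation leb := (lebesgue_rV R N).
Implicit Types (x : 'rV[R]_N) (eps M : R).

(** Both terms on the left of the inequality are gathered in one nonnegative weight, so that they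
    are truncated and passed to the limit together. *)
Definition hardy_weight x :=
  c_o (N%:R + k2) / n%:R * pole_sum a x + beta ^+ 2 / 2 * pole_interaction a x.

Lemma hardy_weight_ge0 x : 0 <= hardy_weight x.
Proof.
apply: addr_ge0; apply: mulr_ge0.
- by rewrite divr_ge0 ?ler0n// /c_o sqr_ge0.
- exact: pole_sum_ge0.
- by rewrite divr_ge0// sqr_ge0.
- exact: pole_interaction_ge0.
Qed.

Lemma ae_not_pole : {ae leb, forall x, forall i, x != a i}.
Proof.
apply: filter_forall => i; exists [set a i]; split.
- exact: measurable_rV_set1.
- exact: lebesgue_rV_set1.
- by move=> x /= /negP; rewrite negbK => /eqP.
Qed.

(* The identity behind [betaE]: [beta (N - 2 + k2) - n beta^2 = c_o (N + k2) / n]. *)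
Lemma hardy_weight_field x : (forall i, x != a i) ->
  beta * (N%:R - 2 + k2) * pole_sum a x - beta ^+ 2 * sqnorm (pole_field a x) =
  hardy_weight x.
Proof.
move=> xa; rewrite pole_field_sqnorm// /hardy_weight /c_o.
have n0 : n%:R != 0 :> R by rewrite pnatr_eq0 -lt0n.
rewrite betaE; move: (pole_sum _ _) (pole_interaction _ _) => Q I.
by field.
Qed.

(** With chi the cutoff, right side minus left side is a sum of four nonnegative terms: (1 - chi)
    |grad v|^2 mu; the square chi mu |grad v + beta v S|^2; the term from the derivative of the
    cutoff; and v^2 chi times the gap in the lower bound on the gradient of mu. The last sum in the
    statement is the one whose integral vanishes. *)
Lemma test_function_pointwise eps v x : 0 < eps -> test_function v ->
  (forall i, x != a i) ->
  (- k1 + \sum_(i < n) k2 * beta / sqnorm (x - a i)) * mu x <=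
    beta * \sum_(i < n) dotv (x - a i) (gmu x) / sqnorm (x - a i) ->
  pole_cutoff a eps x * hardy_weight x * (v x ^+ 2 * mu x) <=
  sqnorm (gradient v x) * mu x +
  k1 * (pole_cutoff a eps x * (v x ^+ 2 * mu x)) +
  beta * \sum_(k < N)
    let psi y := v y * (v y * cut_field a eps k y) in
    (mu x * gradient psi x ord0 k + gmu x ord0 k * psi x).
Proof.
move=> e0 tv xa lb.
set chi := pole_cutoff a eps x; set S := pole_field a x; set Q := pole_sum a x.
set g := gradient v x.
have chi0 : 0 <= chi by exact: pole_cutoff_ge0.
have chi1 : chi <= 1 by exact: pole_cutoff_le1.
have dpsi k : gradient (fun y => v y * (v y * cut_field a eps k y)) x ord0 k =
    2 * v x * g ord0 k * (chi * S ord0 k) +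
    v x ^+ 2 * 'D_(delta_mx ord0 k) (cut_field a eps k) x.
  rewrite mxE.
  have Dv : is_derive x (delta_mx ord0 k) v (g ord0 k).
    by rewrite mxE; apply/derivableP; have [sv _] := tv; have [_] := sv [::]; exact.
  have DF : is_derive x (delta_mx ord0 k) (cut_field a eps k)
      ('D_(delta_mx ord0 k) (cut_field a eps k) x).
    by apply/derivableP; have [_] := smooth_cut_field a k e0 [::]; exact.
  rewrite (@derive_val _ _ _ _ _ _ _ (is_deriveMr Dv (is_deriveMr Dv DF))).
  by rewrite -[cut_field a eps k x]/(chi * S ord0 k); ring.
have E : \sum_(k < N)
    (let psi y := v y * (v y * cut_field a eps k y) in
     mu x * gradient psi x ord0 k + gmu x ord0 k * psi x) =
    mu x * (2 * v x * chi * dotv g S + v x ^+ 2 *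
     (\sum_(k < N) 'D_(delta_mx ord0 k) (cut_field a eps k) x)) +
    v x ^+ 2 * chi * dotv S (gmu x).
  rewrite /dotv !mulr_sumr -big_split/= mulr_sumr -big_split/=.
  by apply: eq_bigr => k _; rewrite dpsi /cut_field -/chi -/S; ring.
rewrite E cut_field_divergence// -/S -/Q -/chi.
(* The lower bound on the weight, rewritten in terms of S and of the sum Q of inverse squared
   distances. *)
have lb' : (- k1 + k2 * beta * Q) * mu x <= beta * dotv S (gmu x).
  rewrite /Q /pole_sum mulr_sumr dotvC dotv_sumr.
  by under [in leRHS]eq_bigr do rewrite dotvZr dotvC mulrC.
rewrite -hardy_weight_field// -/S -/Q.
set Z := 2 * eps * _ / _ * _.
have Z0 : 0 <= Z.
  rewrite mulr_ge0 ?sqnorm_ge0// divr_ge0 ?sqr_ge0//.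
  by rewrite !mulr_ge0 ?pole_prod_ge0// ltW.
(* The completed square |grad v + beta v S|^2, expanded. *)
have sq : 0 <= sqnorm g + 2 * (beta * v x) * dotv g S +
    (beta * v x) ^+ 2 * sqnorm S.
  have := sqnorm_ge0 (g + (beta * v x) *: S).
  by rewrite sqnormD sqnormZ dotvZr mulrA.
have mu0 := mu_ge0 x.
have gg := sqnorm_ge0 g.
have v20 := sqr_ge0 (v x).
have t1 : 0 <= (1 - chi) * (sqnorm g * mu x) by apply: mulr_ge0; [rewrite subr_ge0|exact: mulr_ge0].
have t2 := mulr_ge0 (mulr_ge0 chi0 mu0) sq.
have t3 : 0 <= beta * (mu x * (v x ^+ 2 * Z)).
  apply: mulr_ge0; first exact: ltW.
  by apply: mulr_ge0 => //; exact: mulr_ge0.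
have t4 : 0 <= (v x ^+ 2 * chi) *
    (beta * dotv S (gmu x) - (- k1 + k2 * beta * Q) * mu x).
  apply: mulr_ge0; first exact: mulr_ge0.
  by rewrite subr_ge0.
rewrite -subr_ge0; set t := (X in 0 <= X).
suff -> : t = (1 - chi) * (sqnorm g * mu x) + chi * mu x *
   (sqnorm g + 2 * (beta * v x) * dotv g S + (beta * v x) ^+ 2 * sqnorm S) +
   beta * (mu x * (v x ^+ 2 * Z)) + (v x ^+ 2 * chi) *
    (beta * dotv S (gmu x) - (- k1 + k2 * beta * Q) * mu x).
  by rewrite !addr_ge0.
by rewrite /t; ring.
Qed.

(** * Measurability, bounds and integrability of the weighted terms *)

Lemma measurable_pole_dist2 i : measurable_fun setT (pole_dist2 a i).
Proof.
apply: continuous_rV_measurable.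
exact: (smooth_expr_spec (smooth_expr_pole_dist2 a i)).1.
Qed.

Lemma measurable_pole_sum : measurable_fun setT (pole_sum a).
Proof.
apply: measurable_sum => i; apply: measurable_ge0_inv => [x|].
  exact: pole_dist2_ge0.
exact: measurable_pole_dist2.
Qed.

Lemma measurable_pole_interaction : measurable_fun setT (pole_interaction a).
Proof.
apply: measurable_sum => i; under eq_fun do rewrite big_mkcond.
apply: measurable_sum => j; case: (i != j) => //.
apply: measurable_funM => //; apply: measurable_ge0_inv => [x|].
  by apply: mulr_ge0; exact: pole_dist2_ge0.
by apply: measurable_funM; exact: measurable_pole_dist2.
Qed.

Lemma measurable_hardy_weight : measurable_fun setT hardy_weight.
Proof.
apply: measurable_funD; apply: measurable_funM => //.
  exact: measurable_pole_sum.
exact: measurable_pole_interaction.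
Qed.

Lemma measurable_pole_cutoff eps : 0 < eps ->
  measurable_fun setT (pole_cutoff a eps).
Proof.
move=> e0; apply: continuous_rV_measurable.
by have [] := smooth_pole_cutoff a e0 [::].
Qed.

Lemma truncated_hardy_weight_bounds eps M x : 0 < eps -> 0 <= M ->
  0 <= pole_cutoff a eps x * Num.min (hardy_weight x) M <= M.
Proof.
move=> e0 M0; have W0 := hardy_weight_ge0 x.
have chi0 := pole_cutoff_ge0 a x e0; have chi1 := pole_cutoff_le1 a x e0.
have m0 : 0 <= Num.min (hardy_weight x) M by rewrite le_min W0.
apply/andP; split; first exact: mulr_ge0.
by rewrite -[X in _ <= X]mul1r ler_pM// ge_min lexx orbT.
Qed.

Lemma test_function_sqr_integrable v : test_function v ->
  leb.-integrable setT (EFin \o (fun x => v x ^+ 2 * mu x)).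
Proof.
move=> tv; have [lmu _ _] := mu_grad.
have := L1loc_test_integrable lmu (test_function_mul tv tv.1).
by apply: eq_integrable => // x _; rewrite /= mulrC expr2.
Qed.

Lemma gradient_sqr_integrable v k : test_function v ->
  leb.-integrable setT (EFin \o (fun x => gradient v x ord0 k ^+ 2 * mu x)).
Proof.
move=> tv; have [lmu _ _] := mu_grad; have cg := @gradient_continuous _ _ v k tv.
have cgg : continuous (fun x => gradient v x ord0 k * gradient v x ord0 k).
  by move=> x; exact: (cvgM (cg x) (cg x)).
have := L1locM_integrable lmu cgg tv.2.
move=> int; apply: eq_integrable (int _) => // x.
  by move=> _; rewrite /= mulrC expr2.
by move=> /test_function_vanish[_ ->]; rewrite mxE mulr0.
Qed.

(** The pointwise inequality is integrated. The gradient term is split into coordinates with weight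
    1, so that every term has the shape handled by [cvg_weighted_square]. *)
Lemma test_function_inequality eps M v : 0 < eps -> 0 <= M -> test_function v ->
  \int[leb]_x ((pole_cutoff a eps x * Num.min (hardy_weight x) M) *
    (v x ^+ 2 * mu x)) <=
  \sum_(k < N) \int[leb]_x (1 * (gradient v x ord0 k ^+ 2 * mu x)) +
  k1 * \int[leb]_x (pole_cutoff a eps x * (v x ^+ 2 * mu x)).
Proof.
move=> e0 M0 tv; have iv := test_function_sqr_integrable tv.
have [[/measurable_EFinP mmu _] _ _] := mu_grad.
have mv := continuous_rV_measurable (test_function_continuous tv).
have mchi := measurable_pole_cutoff e0.
have mF : measurable_fun setT (fun x => v x ^+ 2 * mu x).
  by apply: measurable_funM => //; exact: measurable_funX.
have F0 x : 0 <= v x ^+ 2 * mu x by apply: mulr_ge0; [exact: sqr_ge0|].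
have i1 : leb.-integrable setT (EFin \o (fun x =>
    (pole_cutoff a eps x * Num.min (hardy_weight x) M) * (v x ^+ 2 * mu x))).
  apply: dominated_integrable (EFin_integrableZl M iv).
    apply: measurable_funM => //; apply: measurable_funM => //.
    by apply: measurable_minr => //; exact: measurable_hardy_weight.
  move=> x; have /andP[w0 wM] := truncated_hardy_weight_bounds x e0 M0.
  by rewrite ger0_norm ?ler_wpM2r//; exact: mulr_ge0.
have i2 : leb.-integrable setT (EFin \o (fun x =>
    pole_cutoff a eps x * (v x ^+ 2 * mu x))).
  apply: dominated_integrable iv; first exact: measurable_funM.
  move=> x; have chi0 := pole_cutoff_ge0 a x e0.
  rewrite ger0_norm; last exact: mulr_ge0.
  by rewrite ler_piMl//; exact: pole_cutoff_le1.
have i3 k : leb.-integrable setT (EFin \o (fun x =>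
    1 * (gradient v x ord0 k ^+ 2 * mu x))).
  exact: (EFin_integrableZl 1 (gradient_sqr_integrable k tv)).
(* The test function v^2 V_k; this bracketing uses [test_function_mul] twice. *)
pose psi k y := v y * (v y * cut_field a eps k y).
pose h k x := mu x * gradient (psi k) x ord0 k + gmu x ord0 k * psi k x.
have tpsi k : test_function (psi k).
  apply: test_function_mul => //.
  exact: (test_function_mul tv (smooth_cut_field a k e0)).1.
have ih k : leb.-integrable setT (EFin \o h k).
  exact: (weak_gradient_Rintegral k mu_grad (tpsi k)).1.
have h0 k : \int[leb]_x h k x = 0.
  exact: (weak_gradient_Rintegral k mu_grad (tpsi k)).2.
have ish := EFin_integrable_sum (index_enum 'I_N) ih.
have isg := EFin_integrable_sum (index_enum 'I_N) i3.
have R0 : \int[leb]_x (beta * \sum_(k < N) h k x) = 0.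
  by rewrite RintegralZl// Rintegral_sum// big1 ?mulr0.
rewrite -Rintegral_sum// -[X in _ <= _ + X]RintegralZl//.
rewrite -RintegralD//; last exact: (EFin_integrableZl k1 i2).
(* The zero integral supplies the divergence terms of the pointwise inequality. *)
rewrite -[leRHS]addr0 -[X in _ <= _ + X]R0 -RintegralD//; last 2 first.
- exact: (EFin_integrableD isg (EFin_integrableZl k1 i2)).
- exact: (EFin_integrableZl beta ish).
apply: le_ae_Rintegral => //.
  exact: (EFin_integrableD (EFin_integrableD isg (EFin_integrableZl k1 i2))
    (EFin_integrableZl beta ish)).
apply: filterS2 ae_not_pole mu_lb => x xa lb.
apply: le_trans (le_trans _ (test_function_pointwise e0 tv xa lb)) _.
  (* Truncating the weight only lowers the left side. *)
  rewrite ler_wpM2r// ler_wpM2l ?pole_cutoff_ge0// ge_min lexx//.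
rewrite lerD2r lerD2r /sqnorm /dotv mulr_suml.
by apply: ler_sum => k _; rewrite mul1r expr2.
Qed.

End test_function_inequality.

(** * Passage to the limit *)

Lemma cvg_sumr (R : realType) I (r : seq I) (f : I -> nat -> R) (l : I -> R) :
  (forall i, f i j @[j --> \oo] --> l i) ->
  \sum_(i <- r) f i j @[j --> \oo] --> \sum_(i <- r) l i.
Proof.
move=> fl; elim: r => [|i r IH].
  by under eq_fun do rewrite big_nil; rewrite big_nil; exact: cvg_cst.
by under eq_fun do rewrite big_cons; rewrite big_cons; exact: cvgD.
Qed.

Lemma pole_cutoff_cvg (R : realType) (N n : nat) (a : 'I_n -> 'rV[R]_N) x :
  (forall i, x != a i) -> pole_cutoff a (harmonic j) x @[j --> \oo] --> (1 : R).
Proof.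
move=> xa; have P0 : pole_prod a x != 0 by rewrite gt_eqF// pole_prod_gt0.
rewrite -(mulfV P0); apply: cvgM; first exact: cvg_cst.
apply: cvgV => //; rewrite -[X in _ --> X]addr0.
by apply: cvgD; [exact: cvg_cst|exact: cvg_harmonic].
Qed.

(** The inequality is read in [\bar R]: finiteness of the two integrals on the left is part of the
    conclusion. [hbetaE] fixes beta at the value where beta (N - 2 + k2) - n beta^2 equals c_o(N +
    k2)/n. *)
Theorem theorem2p1 (R : realType) (N n : nat) (a : 'I_n -> 'rV[R]_N)
    (beta k1 k2 : R) (mu : 'rV[R]_N -> R) (gmu : 'rV[R]_N -> 'rV[R]_N)
    (hN : (3 <= N)%N) (hn : (1 <= n)%N) (ha : injective a)
    (hbeta : 0 < beta)
    (hmu : forall x, 0 <= mu x)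
    (hH1 : weight_regularity mu gmu)
    (hk2 : 2 - N%:R < k2)
    (hbetaE : beta = (N%:R + k2 - 2) / (2 * n%:R))
    (hH2 : weight_lower_bound a beta k1 k2 mu gmu)
    (phi : 'rV[R]_N -> R) (dphi : 'rV[R]_N -> 'rV[R]_N)
    (hphi : H1mu mu phi dphi) :
  ((c_o (N%:R + k2) / n%:R)%:E *
     \int[lebesgue_rV R N]_x
       ((\sum_(i < n) phi x ^+ 2 / sqnorm (x - a i)) * mu x)%:E +
   (beta ^+ 2 / 2)%:E *
     \int[lebesgue_rV R N]_x
       ((\sum_(i < n) \sum_(j < n | i != j)
           sqnorm (a i - a j) / (sqnorm (x - a i) * sqnorm (x - a j)) *
           phi x ^+ 2) * mu x)%:E
   <= \int[lebesgue_rV R N]_x (sqnorm (dphi x) * mu x)%:E +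
      k1%:E * \int[lebesgue_rV R N]_x (phi x ^+ 2 * mu x)%:E)%E.
Proof.
have N0 : (0 < N)%N by exact: leq_trans hN.
have [mu_grad _ _] := hH1; have [[/measurable_EFinP mmu _] _ _] := mu_grad.
have [mphi mdphi phi_fin dphi_fin [v [tv cv cdv]]] := hphi.
have mdk k : measurable_fun setT (fun x => dphi x ord0 k).
  exact: (measurableT_comp (measurable_coord k) mdphi).
pose F x := phi x ^+ 2 * mu x.
have mF : measurable_fun setT F.
  by apply: measurable_funM => //; exact: measurable_funX.
have F0 x : 0 <= F x by apply: mulr_ge0; [exact: sqr_ge0|].
pose G x := sqnorm (dphi x) * mu x.
have G0 x : 0 <= G x by apply: mulr_ge0; [exact: sqnorm_ge0|].
have mG : measurable_fun setT G.
  by apply: measurable_funM => //; apply: measurable_sum => k; exact: measurable_funM.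
have iF : (lebesgue_rV R N).-integrable setT (EFin \o F).
  apply/integrableP; split; first exact/measurable_EFinP.
  by under eq_integral do rewrite /= ger0_norm//.
have iG : (lebesgue_rV R N).-integrable setT (EFin \o G).
  apply/integrableP; split; first exact/measurable_EFinP.
  by under eq_integral do rewrite /= ger0_norm//.
have sq_le (u : 'rV[R]_N) k : u ord0 k ^+ 2 <= sqnorm u.
  rewrite /sqnorm /dotv (bigD1 k)//= expr2 lerDl.
  by apply: sumr_ge0 => l _; rewrite -expr2 sqr_ge0.
have iGk k : (lebesgue_rV R N).-integrable setT
    (EFin \o (fun x => dphi x ord0 k ^+ 2 * mu x)).
  apply: dominated_integrable iG.
    by apply: measurable_funM => //; exact: measurable_funX.
  move=> x; rewrite ger0_norm; last by apply: mulr_ge0; [exact: sqr_ge0|].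
  exact: ler_wpM2r.
pose eps j : R := harmonic j.
have e0 j : 0 < eps j by exact: harmonic_gt0.
pose W := hardy_weight a beta k2.
have W0 := hardy_weight_ge0 a beta k2.
have mW : measurable_fun setT W := measurable_hardy_weight a beta k2.
pose chi j := pole_cutoff a (eps j).
have mchi j : measurable_fun setT (chi j) := measurable_pole_cutoff a (e0 j).
have chi0 j x : 0 <= chi j x := pole_cutoff_ge0 a x (e0 j).
have chi1 j x : chi j x <= 1 := pole_cutoff_le1 a x (e0 j).
(* A single index j drives both regularizations: eps = 1/(j + 1) and truncation at height j. *)
pose w j x := chi j x * Num.min (W x) j%:R.
have wM j x : 0 <= w j x <= j%:R := truncated_hardy_weight_bounds a beta k2 x (e0 j) (ler0n _ j).
have mw j : measurable_fun setT (w j).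
  by apply: measurable_funM => //; exact: measurable_minr.
have mv m := continuous_rV_measurable (test_function_continuous (tv m)).
have mgv m k := continuous_rV_measurable (@gradient_continuous _ _ _ k (tv m)).
have sqE m x : sqnorm (gradient (v m) x - dphi x) =
    \sum_(l < N) (gradient (v m) x ord0 l - dphi x ord0 l) ^+ 2.
  by apply: eq_bigr => l _; rewrite -expr2 [in LHS]mxE [X in _ + X]mxE.
(* For fixed j all weights are bounded, so the inequality for [v m] passes to the limit in m. *)
have step j : \int[lebesgue_rV R N]_x (w j x * F x) <=
    \int[lebesgue_rV R N]_x G x +
    k1 * \int[lebesgue_rV R N]_x (chi j x * F x).
  have cdk k : (\int[lebesgue_rV R N]_x
      ((gradient (v m) x ord0 k - dphi x ord0 k) ^+ 2 * mu x)%:E)%E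
      @[m --> \oo] --> 0%E.
    (* Each coordinate of the gradient error is dominated by its full norm. *)
    apply: (squeeze_cvge _ (cvg_cst 0%E) cdv); apply: nearW => m.
    apply/andP; split.
      apply: integral_ge0 => x _; rewrite lee_fin.
      by apply: mulr_ge0; [exact: sqr_ge0|].
    apply: ge0_le_integral => //.
    - by move=> x _; rewrite lee_fin; apply: mulr_ge0; [exact: sqr_ge0|].
    - apply/measurable_EFinP; apply: measurable_funM => //.
      by apply: measurable_funX; exact: measurable_funB.
    - apply/measurable_EFinP; apply: measurable_funM => //.
      under eq_fun do rewrite sqE.
      by apply: measurable_sum => l; apply: measurable_funX; exact: measurable_funB.
    move=> x _; rewrite lee_fin ler_wpM2r//.
    rewrite sqE (bigD1 k)//= lerDl.
    by apply: sumr_ge0 => l _; exact: sqr_ge0.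
  have -> : \int[lebesgue_rV R N]_x G x = \sum_(k < N)
      \int[lebesgue_rV R N]_x (1 * (dphi x ord0 k ^+ 2 * mu x)).
    rewrite -Rintegral_sum => [|k]; last exact: (EFin_integrableZl 1 (iGk k)).
    apply: eq_Rintegral => x _; rewrite /G /sqnorm /dotv mulr_suml.
    by apply: eq_bigr => k _; rewrite mul1r expr2.
  apply: (@ler_cvg_to _ _ _ _ _ _ _ _
    (cvg_weighted_square (ler0n _ j) hmu mmu (wM j) (mw j) mphi mv iF _ cv)).
  - by move=> m; exact: (test_function_sqr_integrable mu_grad (tv m)).
  - apply: cvgD.
      apply: cvg_sumr => k; apply: (@cvg_weighted_square _ _ _ _ mu (fun=> 1)
        (fun x => dphi x ord0 k) (fun m x => gradient (v m) x ord0 k) 1) => //.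
      + by move=> x; rewrite ler01 lexx.
      + by move=> m; exact: (gradient_sqr_integrable mu_grad k (tv m)).
    apply: cvgMl_tmp; apply: (@cvg_weighted_square _ _ _ _ mu (chi j) phi v 1) => //.
    + by move=> x; rewrite chi0 chi1.
    + by move=> m; exact: (test_function_sqr_integrable mu_grad (tv m)).
  - apply: nearW => m.
    exact: (test_function_inequality N0 hn hbeta hmu mu_grad hbetaE hH2
      (e0 j) (ler0n _ j) (tv m)).
have [Z [mZ Z0 nZ]] := ae_not_pole a N0.
have nZ_pole x : ~ Z x -> forall i, x != a i.
  by move=> Zx; apply: contrapT => px; exact/Zx/nZ.
have chi_nd x j1 j2 : (j1 <= j2)%N -> chi j1 x <= chi j2 x.
  move=> j12; apply: pole_cutoff_nincr; first exact: e0.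
  by rewrite /eps /= lef_pV2 ?posrE// ler_nat.
have ndM (u : R^nat) (c : R) : 0 <= c ->
    (forall j1 j2, (j1 <= j2)%N -> u j1 <= u j2) ->
    nondecreasing_seq (fun j => (u j * c)%:E).
  by move=> c0 nu j1 j2 /nu u12; rewrite lee_fin ler_wpM2r.
have cvM (u : R^nat) (c l : R) : u j @[j --> \oo] --> l ->
    (u j * c)%:E @[j --> \oo] --> (l * c)%:E.
  move=> ul; apply: cvg_EFin; first exact: nearW.
  by apply: cvgMr_tmp.
have cW : (\int[lebesgue_rV R N]_x (w j x * F x)%:E)%E @[j --> \oo] -->
    (\int[lebesgue_rV R N]_x (W x * F x)%:E)%E.
  apply: (cvg_ae_monotone_convergence mZ Z0).
  - by move=> j; apply/measurable_EFinP; exact: measurable_funM.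
  - by move=> j x; rewrite lee_fin mulr_ge0//; case/andP: (wM j x).
  - move=> x; apply: ndM => // j1 j2 j12; rewrite /w ler_pM//.
    + by rewrite le_min W0/=.
    + exact: chi_nd.
    + by rewrite le_min !ge_min lexx/= ler_nat j12 orbT.
  - by apply/measurable_EFinP; exact: measurable_funM.
  - by move=> x; rewrite lee_fin mulr_ge0.
  - move=> x /nZ_pole xa; apply: cvM; rewrite -[W x]mul1r; apply: cvgM.
      exact: pole_cutoff_cvg.
    (* The truncation at x is inactive as soon as j >= W x. *)
    apply: cvg_near_cst; near=> j; apply/min_idPl.
    by near: j; exact: nbhs_infty_ger.
(* The limit is taken before multiplying by k1, whose sign is arbitrary. *)
have cchi : (\int[lebesgue_rV R N]_x (chi j x * F x)%:E)%E @[j --> \oo] -->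
    (\int[lebesgue_rV R N]_x (F x)%:E)%E.
  apply: (cvg_ae_monotone_convergence mZ Z0).
  - by move=> j; apply/measurable_EFinP; exact: measurable_funM.
  - by move=> j x; rewrite lee_fin mulr_ge0.
  - by move=> x; apply: ndM => // j1 j2; exact: chi_nd.
  - exact/measurable_EFinP.
  - by move=> x; rewrite lee_fin.
  - move=> x /nZ_pole xa; have := cvM _ (F x) _ (pole_cutoff_cvg xa).
    by rewrite mul1r.
have iwF j : (lebesgue_rV R N).-integrable setT (EFin \o (fun x => w j x * F x)).
  apply: dominated_integrable (EFin_integrableZl j%:R iF).
    exact: measurable_funM.
  move=> x; have /andP[w0 wj] := wM j x.
  by rewrite ger0_norm ?ler_wpM2r//; exact: mulr_ge0.
have ichiF j : (lebesgue_rV R N).-integrable setT (EFin \o (fun x => chi j x * F x)).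
  apply: dominated_integrable iF; first exact: measurable_funM.
  move=> x; rewrite ger0_norm; last exact: mulr_ge0.
  by rewrite ler_piMl.
have main : (\int[lebesgue_rV R N]_x (W x * F x)%:E <=
    \int[lebesgue_rV R N]_x (G x)%:E +
    k1%:E * \int[lebesgue_rV R N]_x (F x)%:E)%E.
  apply: (lee_cvg_to cW (cvgeD _ (cvg_cst _) (cvgeZl _ cchi))) => //.
    by rewrite fin_num_adde_defr//; exact: (integrable_fin_num _ iG).
  apply: nearW => j /=; have := step j; rewrite -lee_fin EFinD EFinM /Rintegral.
  rewrite !fineK//.
  - exact: integrable_fin_num (ichiF j).
  - exact: integrable_fin_num iG.
  - exact: integrable_fin_num (iwF j).
apply: le_trans main.
have mQ := measurable_pole_sum a; have mI := measurable_pole_interaction a.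
have Zl (c : R) (f : 'rV[R]_N -> R) : 0 <= c -> measurable_fun setT f ->
    (forall x, 0 <= f x) -> (c%:E * \int[lebesgue_rV R N]_x (f x)%:E =
    \int[lebesgue_rV R N]_x (c * f x)%:E)%E.
  move=> c0 mf f0; rewrite -ge0_integralZl_EFin//; last exact/measurable_EFinP.
  by move=> x _; rewrite lee_fin.
(* The integrands of the statement are brought to the form weight times F, so that the two left
   integrals add up to that of W F. *)
under eq_integral => x _.
  rewrite (_ : _ * mu x = pole_sum a x * F x); last first.
    by rewrite /F mulrA; congr (_ * _); rewrite -mulr_sumr mulrC.
  over.
under [X in (_ + _ * X <= _)%E]eq_integral => x _.
  rewrite (_ : _ * mu x = pole_interaction a x * F x); last first.
    rewrite /F mulrA; congr (_ * _); rewrite mulr_suml; apply: eq_bigr => i _.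
    by rewrite mulr_suml.
  over.
have QF0 x : 0 <= pole_sum a x * F x by rewrite mulr_ge0// pole_sum_ge0.
have IF0 x : 0 <= pole_interaction a x * F x.
  by rewrite mulr_ge0// pole_interaction_ge0.
have mQF : measurable_fun setT (fun x => pole_sum a x * F x).
  exact: measurable_funM.
have mIF : measurable_fun setT (fun x => pole_interaction a x * F x).
  exact: measurable_funM.
have c0 : 0 <= c_o (N%:R + k2) / n%:R by rewrite divr_ge0// sqr_ge0.
have b0 : 0 <= beta ^+ 2 / 2 by rewrite divr_ge0// sqr_ge0.
rewrite Zl// Zl// -ge0_integralD//; last 4 first.
- by move=> x _; rewrite lee_fin mulr_ge0.
- by apply/measurable_EFinP; exact: measurable_funM.
- by move=> x _; rewrite lee_fin mulr_ge0.
- by apply/measurable_EFinP; exact: measurable_funM.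
rewrite le_eqVlt; apply/orP; left; apply/eqP; apply: eq_integral => x _.
by rewrite -EFinD /W /hardy_weight; congr EFin; ring.
Unshelve. all: by end_near. Qed.
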